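(* Let $P=\{p_1,\dots,p_d\}$ be a finite poset and $G$ a perfect graph on $[d]$. Then $\delta(\mathcal{O}_P*\mathcal{Q}_G,\lambda)=\delta(\Gamma(\mathcal{O}_P,\mathcal{Q}_G),\lambda)$. In particular, $\mathcal{O}_P*\mathcal{Q}_G$ is Gorenstein of index $2$ and $\mathrm{Vol}(\mathcal{O}_P*\mathcal{Q}_G)=\mathrm{Vol}(\Gamma(\mathcal{O}_P,\mathcal{Q}_G))$.
   Context: Identify $p_j$ with $j$; $\rho(X)=\sum_{j\in X}\mathbf{e}_j$. $\mathcal{O}_P$ is the convex hull of $\rho(I)$ over poset ideals (down-closed subsets) $I$ of $P$; $\mathcal{Q}_G$ is the convex hull of $\rho(S)$ over stable sets $S$ of $G$ (including $\emptyset$). $\mathcal{O}_P*\mathcal{Q}_G\subset\mathbb{R}^{d+1}$ is the convex hull of $(\mathcal{O}_P\times\{1\})\cup(\mathcal{Q}_G\times\{0\})$. For lattice polytopes $\mathcal{P},\mathcal{Q}\subset\mathbb{R}^d$, $\Gamma(\mathcal{P},\mathcal{Q})=\mathrm{conv}(\mathcal{P}\cup(-\mathcal{Q}))$. For an $n$-dimensional lattice polytope $\mathcal{P}\subset\mathbb{R}^n$, the Ehrhart $\delta$-polynomial is $\delta(\mathcal{P},\lambda)=(1-\lambda)^{n+1}\bigl[1+\sum_{k\ge1}|k\mathcal{P}\cap\mathbb{Z}^n|\lambda^k\bigr]$, and the normalized volume is $\mathrm{Vol}(\mathcal{P})=\delta(\mathcal{P},1)$. $\mathcal{P}$ is reflexive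 if the origin is in its interior and its dual $\{\mathbf{x}:\langle\mathbf{x},\mathbf{y}\rangle\le1\ \forall\mathbf{y}\in\mathcal{P}\}$ is a lattice polytope; $\mathcal{P}$ is Gorenstein of index $r$ if $r\mathcal{P}$ is unimodularly equivalent to a reflexive polytope. A graph is perfect if every induced subgraph has chromatic number equal to its maximum clique size. *)

(* Defs.v *)
From mathcomp Require Import all_boot all_order all_algebra.
From mathcomp Require Import finmap boolp classical_sets cardinality fsbigop.
From mathcomp Require Import reals topology normedtype convex.

Set Implicit Arguments.
Unset Strict Implicit.
Unset Printing Implicit Defensive.

Import Order.TTheory GRing.Theory Num.Theory numFieldNormedType.Exports.

Local Open Scope classical_set_scope.
Local Open Scope ring_scope.

Record simple_graph (V : finType) := SimpleGraph {
  adj :> rel V;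
  adj_sym : symmetric adj;
  adj_irr : irreflexive adj }.

Section Graphs.
Variable V : finType.
Implicit Types (G : simple_graph V) (S W : {set V}).

Definition is_clique G S : bool :=
  [forall x in S, forall y in S, (x != y) ==> adj G x y].

Definition is_stable G S : bool :=
  [forall x in S, forall y in S, ~~ adj G x y].

Definition clique_number G : nat := \max_(S : {set V} | is_clique G S) #|S|.

Definition is_colorable G (k : nat) : bool :=
  [exists c : {ffun V -> 'I_k}, forall x, forall y, adj G x y ==> (c x != c y)].

Lemma ex_colorable G : exists k, is_colorable G k.
Proof.
exists #|V|; apply/existsP; exists [ffun x => enum_rank x].
apply/forallP => x; apply/forallP => y; apply/implyP => xy; rewrite !ffunE.
by apply: contraTneq xy => /enum_rank_inj ->; rewrite adj_irr.
Qed.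

Definition chromatic_number G : nat := ex_minn (ex_colorable G).

Definition induced_subgraph G W : simple_graph {x : V | x \in W} :=
  @SimpleGraph {x : V | x \in W} (fun x y => adj G (val x) (val y))
    (fun x y => adj_sym G (val x) (val y)) (fun x => adj_irr G (val x)).

End Graphs.

Definition is_perfect (V : finType) (G : simple_graph V) : Prop :=
  forall W : {set V},
    chromatic_number (induced_subgraph G W) =
    clique_number (induced_subgraph G W).

Definition is_ideal (disp : Order.disp_t) (P : finPOrderType disp)
    (I : {set P}) : bool :=
  [forall x in I, forall y, (y <= x)%O ==> (y \in I)].

Section Polytopes.
Variable R : realType.

Definition convex_hull (n : nat) (A : set 'rV[R]_n) : set 'rV[R]_n :=
  smallest (@convex_set R 'rV[R]_n) A.

Definition lattice_vec (n : nat) (z : 'rV[int]_n) : 'rV[R]_n :=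
  map_mx intr z.

Definition lattice_polytope (n : nat) (A : set 'rV[R]_n) : Prop :=
  exists s : seq 'rV[int]_n,
    A = convex_hull [set lattice_vec z | z in [set` s]].

Definition dilate (n : nat) (k : nat) (A : set 'rV[R]_n) : set 'rV[R]_n :=
  [set k%:R *: x | x in A].

Definition lattice_count (n : nat) (A : set 'rV[R]_n) : nat :=
  #|` fset_set (A `&` range (@lattice_vec n)) |.

Definition ehrhart_coef (n : nat) (A : set 'rV[R]_n) (k : nat) : int :=
  if k is 0%N then 1 else (lattice_count (dilate k A))%:Z.

(* The Ehrhart delta-polynomial, as the sequence of coefficients of the formal
   power series (1 - X)^(n+1) (1 + \sum_(k >= 1) |kA \cap Z^n| X^k); for an
   n-dimensional lattice polytope all but finitely many of them vanish. *)
Definition delta_coef (n : nat) (A : set 'rV[R]_n) (k : nat) : int :=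
  \sum_(i < k.+1) ((1 - 'X : {poly int}) ^+ n.+1)`_i * ehrhart_coef A (k - i).

(* The value of the delta-polynomial at 1, i.e. the (finitely supported) sum of
   its coefficients. *)
Definition normalized_volume (n : nat) (A : set 'rV[R]_n) : int :=
  \sum_(k \in [set: nat]) delta_coef A k.

Definition dot (n : nat) (x y : 'rV[R]_n) : R := \sum_(i < n) x 0 i * y 0 i.

Definition polar_dual (n : nat) (A : set 'rV[R]_n) : set 'rV[R]_n :=
  [set x | forall y, A y -> dot x y <= 1].

Definition reflexive_polytope (n : nat) (A : set 'rV[R]_n) : Prop :=
  [/\ lattice_polytope A, A° 0 & lattice_polytope (polar_dual A)].

Definition unimodularly_equivalent (n : nat) (A B : set 'rV[R]_n) : Prop :=
  exists (U : 'M[int]_n) (w : 'rV[int]_n),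
    U \in unitmx /\ B = [set x *m map_mx intr U + lattice_vec w | x in A].

Definition gorenstein_of_index (n r : nat) (A : set 'rV[R]_n) : Prop :=
  lattice_polytope A /\
  exists2 B : set 'rV[R]_n,
    reflexive_polytope B & unimodularly_equivalent (dilate r A) B.

Definition join_polytope (d : nat) (A B : set 'rV[R]_d) : set 'rV[R]_(d + 1) :=
  convex_hull ([set row_mx x (const_mx 1) | x in A] `|`
               [set row_mx x (const_mx 0) | x in B]).

Definition Gamma (d : nat) (A B : set 'rV[R]_d) : set 'rV[R]_d :=
  convex_hull (A `|` [set - x | x in B]).

Definition rho (d : nat) (X : {set 'I_d}) : 'rV[R]_d :=
  \sum_(j in X) delta_mx 0 j.

(* The enumeration [p] of the poset identifies [p j] with the index [j]. *)
Definition order_polytope (d : nat) (disp : Order.disp_t)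
    (P : finPOrderType disp) (p : 'I_d -> P) : set 'rV[R]_d :=
  convex_hull [set rho (p @^-1: I) | I in [set I : {set P} | is_ideal I]].

Definition stable_set_polytope (d : nat) (G : simple_graph 'I_d) :
    set 'rV[R]_d :=
  convex_hull [set rho S | S in [set S : {set 'I_d} | is_stable G S]].

End Polytopes.

(* Main.v *)
Require Import Defs.
From mathcomp Require Import all_boot all_order all_algebra.
From mathcomp Require Import reals.
From HB Require Import structures.
From mathcomp Require Import finmap boolp classical_sets cardinality fsbigop.
From mathcomp Require Import topology normedtype convex interval_inference.
From mathcomp Require Import ring lra zify.

(** For a perfect graph, Lovász's replication argument describes the dilates of
    [Q_G] by [x >= 0] and the clique inequalities.  If [y = a - b] with [a] in
    [t O_P] and [b] in [s Q_G], then [a] may be replaced by the smallest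
    nonnegative order-reversing function [c(y)] above [y]; hence a lattice point
    [y] lies in [k Gamma] iff [max c(y) + \sum_C (c(y) - y) <= k] for all cliques
    [C].  Stanley's transfer map [z_j = y_j - max(0, max_(l > j) y_l)] turns this
    condition into [\sum_D z^+ + \sum_C z^- <= k] for all chains [D] and cliques
    [C], which only depends on the comparability graph of [P]: the count is the
    same for the dual poset.

    The shear [(x, t) |-> (t - x, t)] maps a lattice point of [k (O_P * Q_G)] to a
    pair [(y, t)] with [max c'(y) <= t] and [\sum_C (c'(y) - y) <= k - t], where
    [c'] refers to the dual poset.  Splitting off the pairs with [t = max c'(y)],
    the count for [k + 1] is the count for [k] plus the number of lattice points
    of the [(k + 1)]-st dilate of the [Gamma] of the dual poset, which gives the
    equality of the delta-polynomials.

    For the Gorenstein property, all the inequalities describing [2 (O_P * Q_G)]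
    turn out to be at lattice distance one from the point [(1, ..., 1)], so that
    after translation the dual polytope is the convex hull of their normals. *)

Set Implicit Arguments.
Unset Strict Implicit.
Unset Printing Implicit Defensive.

Import Order.TTheory GRing.Theory Num.Theory numFieldNormedType.Exports.

(** * Weighted colourings of perfect graphs *)

Section PerfectGraphs.

Lemma clique_adj (V : finType) (G : simple_graph V) (C : {set V}) x y :
  is_clique G C -> x \in C -> y \in C -> x != y -> adj G x y.
Proof.
by move/forall_inP=> + xC => /(_ x xC)/forall_inP + yC => /(_ y yC)/implyP;
  apply.
Qed.

Variables (V : finType) (G : simple_graph V).
Implicit Types (S C K : {set V}) (w : V -> nat) (s : seq {set V}).

Definition cover_mult s (v : V) : nat := \sum_(S <- s) (v \in S).

Definition is_clique_bounded w k :=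
  forall C, is_clique G C -> \sum_(v in C) w v <= k.

Lemma stable_adj S x y : is_stable G S -> x \in S -> y \in S -> ~~ adj G x y.
Proof. by move/forall_inP=> + xC => /(_ x xC)/forall_inP; apply. Qed.

Lemma sum_mem C S : \sum_(v in C) (v \in S) = #|C :&: S|.
Proof.
rewrite -sum1_card [RHS](eq_bigl (fun v => (v \in C) && (v \in S))) => [|v];
  last by rewrite inE.
by rewrite big_mkcondr; apply: eq_bigr => v _; case: (v \in S).
Qed.

Lemma card_clique_stable C S :
  is_clique G C -> is_stable G S -> #|C :&: S| <= 1.
Proof.
move=> cC sS; apply/card_le1_eqP => x y /setIP[xC xS] /setIP[yC yS].
apply/eqP; apply: contraT => nxy.
by have /negP[] := stable_adj sS xS yS; apply: (clique_adj cC);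
  rewrite // eq_sym.
Qed.

Lemma sum_cover_mult C s :
  is_clique G C -> all (is_stable G) s ->
    \sum_(v in C) cover_mult s v <= size s.
Proof.
move=> cC /allP sS; rewrite /cover_mult exchange_big /= -sum1_size !big_seq.
by apply: leq_sum => S /sS ?; rewrite sum_mem card_clique_stable.
Qed.

Lemma is_stable0 : is_stable G finset.set0.
Proof. by apply/forall_inP => x; rewrite inE. Qed.

Lemma is_clique1 v : is_clique G [set v].
Proof.
apply/forall_inP => x /set1P ->; apply/forall_inP => y /set1P ->.
by rewrite eqxx.
Qed.

Lemma is_clique0 : is_clique G finset.set0.
Proof. by apply/forall_inP => x; rewrite inE. Qed.

(** The unweighted case: perfection colours the subgraph induced on [W] with at most [k] colours,
    and the colour classes are stable sets covering each vertex of [W] once. *)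
Lemma perfect_cover_set (W : {set V}) k :
  is_perfect G -> is_clique_bounded (fun v => v \in W) k ->
  exists s,
    [/\ size s = k, all (is_stable G) s & cover_mult s =1 fun v => v \in W].
Proof.
move=> pG bW; pose H := induced_subgraph G W.
have lek : chromatic_number H <= k.
  rewrite (pG W); apply/bigmax_leqP => /= C cC.
  have /bW : is_clique G [set val x | x in C].
    apply/forall_inP => _ /imsetP[x xC ->];
      apply/forall_inP => _ /imsetP[y yC ->].
    by apply/implyP => nxy; apply: (@clique_adj _ H C) => //;
      apply: contra nxy => /eqP ->.
  apply: leq_trans.
  rewrite sum_mem; have /finset.setIidPl -> : [set val x | x in C] \subset W.
    by apply/fintype.subsetP => _ /imsetP[x _ ->]; apply: valP.
  by rewrite card_imset //; apply: val_inj.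
have /existsP[c /forallP col] : is_colorable H (chromatic_number H).
  by rewrite /chromatic_number; case: ex_minnP.
set n := chromatic_number H in lek c col.
pose F (i : 'I_n) : {set V} := [set val x | x in [set x | c x == i]].
(* Empty stable sets pad the list to length exactly [k]. *)
exists ([seq F i | i <- enum 'I_n] ++ nseq (k - n) finset.set0); split.
- by rewrite size_cat size_map size_nseq size_enum_ord subnKC.
- rewrite all_cat all_nseq is_stable0 orbT andbT all_map; apply/allP => i _ /=.
  apply/forall_inP => _ /imsetP[x /[!inE]/eqP xi ->].
  apply/forall_inP => _ /imsetP[y /[!inE]/eqP yi ->].
  by have /forallP/(_ y) := col x; rewrite xi yi eqxx implybF.
- move=> v; rewrite /cover_mult big_cat big_map big_nseq /=.
  rewrite [X in _ + X](_ : _ = 0) ?addn0; last first.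
    by elim: (_ - _) => //= m ->; rewrite inE.
  rewrite big_enum /=; case: (boolP (v \in W)) => vW.
    rewrite (bigD1 (c (exist _ v vW))) //= big1 ?addn0.
      by rewrite (imset_f _ (x := exist _ v vW)) // inE.
    move=> i ni; apply/eqP; rewrite eqb0;
      apply: contra ni => /imsetP[x /[!inE]/eqP <- vx].
    by apply/eqP; congr (c _); apply: val_inj.
  rewrite big1 // => i _; apply/eqP; rewrite eqb0;
    apply: contra vW => /imsetP[x _ ->].
  exact: valP.
Qed.

(* Lovász's replication argument: one copy of a vertex [v] of weight at least
   two is removed, and a colour class [K] of the remaining weight that contains
   [v] is split off; what is left, with the copy of [v] put back, satisfies the
   clique bound for one colour less. *)
Lemma perfect_weighted_cover w k :
  is_perfect G -> is_clique_bounded w k ->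
  exists s, [/\ size s = k, all (is_stable G) s & cover_mult s =1 w].
Proof.
move=> pG; have [n] := ubnP (\sum_v w v); elim: n => // n IH in w k * => lew bw.
(* If no weight exceeds one, [w] is the indicator of its support. *)
have [v wv|w1] := pickP (fun v => 1 < w v); last first.
  have wE v : w v = (v \in [set v | 0 < w v]).
    by rewrite inE; have := w1 v; case: (w v) => [|[]].
  have [|s [ss st sE]] := @perfect_cover_set [set v | 0 < w v] k pG.
    by move=> C /bw; apply: leq_trans; apply: leq_sum => u _; rewrite -wE.
  by exists s; split=> // u; rewrite sE -wE.
pose w' u := w u - (u == v).
have wE u : w u = w' u + (u == v).
  by rewrite /w' subnK //; case: eqP => // ->; apply: ltnW.
have sumv : \sum_u (u == v : nat) = 1.
  by rewrite (bigD1 v) //= eqxx big1 // => u /negPf ->.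
have sumw : \sum_u w u = (\sum_u w' u).+1.
  by rewrite (eq_bigr _ (fun u _ => wE u)) big_split /= sumv addn1.
have [|C /bw|s [ss st sE]] := IH w' k.
- by rewrite -ltnS -sumw.
- by apply: leq_trans; apply: leq_sum => u _; apply: leq_subr.
have [K Ks vK] : exists2 K, K \in s & v \in K.
  apply/hasP; apply: contraTT wv => /hasPn nK.
  have : cover_mult s v = 0.
    by rewrite /cover_mult big_seq big1 // => S /nK /negPf ->.
  by rewrite sE /w' eqxx => /eqP; rewrite subn_eq0 -leqNgt.
pose s' := rem K s; pose w'' u := cover_mult s' u + (u == v).
have {ss} kE : k = (size s').+1.
  by rewrite size_rem // prednK -?ss //; case: (s) Ks.
have sE' u : w' u = (u \in K) + cover_mult s' u.
  by rewrite -sE /cover_mult (perm_big _ (perm_to_rem Ks)) big_cons.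
have wE'' u : w u = (u \in K) + w'' u by rewrite wE sE' addnA.
have st' : all (is_stable G) s'.
  by apply/allP => S /mem_rem; apply: (allP st).
have [||s'' [ss'' st'' sE'']] := IH w'' (size s').
- have : \sum_u w u = #|K| + \sum_u w'' u.
    by rewrite (eq_bigr _ (fun u _ => wE'' u)) big_split /= -big_mkcond
      sum1_card.
  have : 0 < #|K| by apply/card_gt0P; exists v.
  move: lew => + + e; rewrite e.
  by case: #|K| => // m; rewrite addSn ltnS => lt _; apply: leq_ltn_trans lt;
    rewrite leq_addl.
(* If [v] lies in [C], then [K] meets [C], so splitting it off lowers the weight of [C]; otherwise
   [w''] on [C] counts the sets of [s'], each meeting [C] at most once. *)
- move=> C cC; case: (boolP (v \in C)) => vC.
    have := bw C cC; rewrite (eq_bigr _ (fun u _ => wE'' u)) big_split /=.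
    rewrite sum_mem kE; have : 0 < #|C :&: K| by apply/card_gt0P; exists v;
      rewrite inE vC.
    by case: #|_| => // m _; rewrite addSn ltnS; apply: leq_trans;
      apply: leq_addl.
  rewrite big_split /= [X in _ + X]big1 ?addn0 ?sum_cover_mult // => u uC.
  by case: eqP vC uC => // -> /negPf ->.
exists (K :: s''); split=> /=.
- by rewrite ss''.
- by rewrite (allP st).
- by move=> u; rewrite /cover_mult big_cons -/(cover_mult s'' u) sE'' wE''.
Qed.

End PerfectGraphs.

Local Open Scope classical_set_scope.
Local Open Scope ring_scope.

(** * Farkas' lemma and convex hulls *)

Section Convexity.
Variable R : realType.

Section Dot.
Variable n : nat.
Implicit Types x y z : 'rV[R]_n.

Lemma dotC x y : dot x y = dot y x.
Proof. by apply: eq_bigr => i _; rewrite mulrC. Qed.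

Lemma dot_is_scalar x : scalar (dot x).
Proof.
move=> t y z; rewrite /dot mulr_sumr -big_split; apply: eq_bigr => i _ /=.
by rewrite !mxE mulrDr mulrCA.
Qed.

HB.instance Definition _ x :=
  GRing.isLinear.Build R 'rV[R]_n R *%R (dot x) (dot_is_scalar x).

Lemma dotDr x y z : dot x (y + z) = dot x y + dot x z.
Proof. exact: linearD. Qed.

Lemma dotBr x y z : dot x (y - z) = dot x y - dot x z.
Proof. exact: linearB. Qed.

Lemma dotZr x t y : dot x (t *: y) = t * dot x y.
Proof. exact: linearZ. Qed.

Lemma dot0r x : dot x 0 = 0.
Proof. exact: linear0. Qed.

Lemma dot0l x : dot 0 x = 0.
Proof. by rewrite dotC dot0r. Qed.

Lemma dotNl x y : dot (- x) y = - dot x y.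
Proof. by rewrite dotC linearN /= dotC. Qed.

Lemma dotDl x y z : dot (x + y) z = dot x z + dot y z.
Proof. by rewrite dotC dotDr !(dotC z). Qed.

Lemma dotBl x y z : dot (x - y) z = dot x z - dot y z.
Proof. by rewrite dotC dotBr !(dotC z). Qed.

Lemma dotZl t x y : dot (t *: x) y = t * dot x y.
Proof. by rewrite dotC dotZr dotC. Qed.

End Dot.

Lemma dot_row_mx m n (x1 y1 : 'rV[R]_m) (x2 y2 : 'rV[R]_n) :
  dot (row_mx x1 x2) (row_mx y1 y2) = dot x1 y1 + dot x2 y2.
Proof.
rewrite /dot big_split_ord; congr (_ + _); apply: eq_bigr => i _.
  by rewrite !row_mxEl.
by rewrite !row_mxEr.
Qed.

Lemma dot_const1 (a b : R) : dot (const_mx a : 'rV_1) (const_mx b) = a * b.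
Proof. by rewrite /dot big_ord1 !mxE. Qed.

(* Bartl's induction on the number of inequalities: a point [x0] violating the
   conclusion for the first [m] of them serves to project the last one away. *)
Lemma farkas n m (a : nat -> 'rV[R]_n) (g : 'rV[R]_n) :
  (forall x, (forall i, (i < m)%N -> dot (a i) x <= 0) -> dot g x <= 0) ->
  exists2 l : nat -> R, forall i, 0 <= l i & g = \sum_(i < m) l i *: a i.
Proof.
elim: m a g => [|m IH] a g gP.
  exists (fun=> 0) => //; rewrite big_ord0; apply/rowP => i; rewrite mxE.
  have dg x : dot g x = 0.
    by apply/eqP; rewrite eq_le gP //= -oppr_le0 -linearN gP.
  have := dg g; rewrite /dot => /eqP; rewrite psumr_eq0 => [|j _];
    last exact: sqr_ge0.
  by move=> /allP/(_ i (mem_index_enum i)); rewrite mulf_eq0 orbb => /eqP.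
have [/IH[l l0 gE]|] :=
    pselect (forall x, (forall i, (i < m)%N -> dot (a i) x <= 0) ->
      dot g x <= 0).
  exists (fun i => if i == m then 0 else l i) => [i|]; first by case: ifP.
  rewrite big_ord_recr /= eqxx scale0r addr0 gE.
  by apply: eq_bigr => i _; rewrite ltn_eqF.
move=> /existsNP[x /not_implyP[ax /negP]]; rewrite -ltNge => gx.
have amx : 0 < dot (a m) x.
  rewrite ltNge; apply/negP => amx; move: gx; rewrite ltNge gP // => i.
  by rewrite ltnS leq_eqVlt => /predU1P[->//|]; apply: ax.
pose x0 := (dot (a m) x)^-1 *: x.
have amx0 : dot (a m) x0 = 1 by rewrite dotZr mulVf // gt_eqF.
have ax0 i : (i < m)%N -> dot (a i) x0 <= 0.
  by move=> im; rewrite dotZr pmulr_rle0 ?invr_gt0 // ax.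
have gx0 : 0 < dot g x0 by rewrite dotZr mulr_gt0 ?invr_gt0.
clearbody x0; pose proj h := h - dot h x0 *: a m.
(* Applying [proj h] to [y] is applying [h] to the projection of [y] along [x0] onto the kernel of
   [a m]. *)
have projE h y : dot (proj h) y = dot h (y - dot (a m) y *: x0).
  by rewrite dotBl dotBr dotZl dotZr; ring.
have [y ay|l l0 gE] := IH (fun i => proj (a i)) (proj g).
  rewrite projE; apply: gP => i; rewrite ltnS leq_eqVlt => /predU1P[->|im].
    by rewrite dotBr dotZr amx0 mulr1 subrr.
  by rewrite -projE ay.
(* The part of [g] at [x0] that [a m] must supply; it is nonnegative because [g] is positive there
   and the other [a i] are nonpositive. *)
pose c := dot g x0 - \sum_(i < m) l i * dot (a i) x0.
exists (fun i => if i == m then c else l i) => [i|].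
  case: eqP => // _; rewrite subr_ge0 (le_trans _ (ltW gx0)) //.
  by apply: sumr_le0 => j _; rewrite mulr_ge0_le0 ?ax0.
rewrite big_ord_recr /= eqxx scalerBl [_ *: a m + _]addrC addrA.
rewrite -[LHS](subrK (dot g x0 *: a m)) -/(proj g) gE; congr (_ + _).
rewrite scaler_suml -sumrB; apply: eq_bigr => i _.
by rewrite ltn_eqF // scalerBr scalerA.
Qed.

Lemma convex_setP n (A : set 'rV[R]_n) :
  convex_set A <->
  forall x y t, 0 <= t -> t <= 1 -> A x -> A y -> A (t *: x + (1 - t) *: y).
Proof.
split=> [cA x y t t0 t1 Ax Ay|cA x y t /set_mem Ax /set_mem Ay].
  by have := cA x y (Itv01 t0 t1) (mem_set Ax) (mem_set Ay) => /set_mem.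
by apply/mem_set; apply: cA.
Qed.

Lemma convex_hull_convex n (A : set 'rV[R]_n) : convex_set (convex_hull A).
Proof.
apply/convex_setP => x y t t0 t1 Ax Ay B [cB AB].
by apply: (convex_setP _).1 => //; [apply: Ax|apply: Ay].
Qed.

Lemma sub_convex_hull n (A : set 'rV[R]_n) : A `<=` convex_hull A.
Proof. exact: sub_smallest. Qed.

Lemma convex_hull_min n (A B : set 'rV[R]_n) :
  convex_set B -> A `<=` B -> convex_hull A `<=` B.
Proof. exact: smallest_sub. Qed.

Lemma convex_hullS n (A B : set 'rV[R]_n) :
  A `<=` B -> convex_hull A `<=` convex_hull B.
Proof.
move=> AB; apply: convex_hull_min; first exact: convex_hull_convex.
exact: subset_trans (@sub_convex_hull _ _).
Qed.

Lemma convex_hullU n (A B : set 'rV[R]_n) :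
  convex_hull (convex_hull A `|` convex_hull B) = convex_hull (A `|` B).
Proof.
apply/seteqP; split; last by apply: convex_hullS; apply: setUSS;
  apply: sub_convex_hull.
apply: convex_hull_min; first exact: convex_hull_convex.
by move=> x [] /=; apply: convex_hullS => y; [left|right].
Qed.

Definition affine_map m n (f : 'rV[R]_m -> 'rV[R]_n) :=
  forall t x y, f (t *: x + (1 - t) *: y) = t *: f x + (1 - t) *: f y.

Lemma convex_hull_image m n (f : 'rV[R]_m -> 'rV[R]_n) (A : set 'rV[R]_m) :
  affine_map f -> convex_hull (f @` A) = f @` convex_hull A.
Proof.
move=> fA; apply/seteqP; split.
  apply: convex_hull_min; last exact: image_subset (@sub_convex_hull _ _).
  apply/convex_setP => _ _ t t0 t1 [x Ax <-] [y Ay <-].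
  exists (t *: x + (1 - t) *: y) => //.
  exact: (convex_setP _).1 (@convex_hull_convex _ _) _ _ _ t0 t1 Ax Ay.
move=> _ [x Ax <-];
  suff : convex_hull A `<=` f @^-1` (convex_hull (f @` A)) by exact.
apply: convex_hull_min => [|y Ay]; last by apply: sub_convex_hull; exists y.
apply/convex_setP => y z t t0 t1 Ay Az; rewrite /preimage /= fA.
exact: (convex_setP _).1 (@convex_hull_convex _ _) _ _ _ t0 t1 Ay Az.
Qed.

Lemma convex_combination n m (A : set 'rV[R]_n) (v : nat -> 'rV[R]_n)
    (l : nat -> R) :
  convex_set A -> (forall i, (i < m)%N -> A (v i)) -> (forall i, 0 <= l i) ->
  \sum_(i < m) l i = 1 -> A (\sum_(i < m) l i *: v i).
Proof.
move=> cA vA l0 l1.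
(* Partial sums of the coefficients need not be one, so the induction allows any positive total
   mass. *)
suff : 0 < \sum_(i < m) l i ->
       A ((\sum_(i < m) l i)^-1 *: \sum_(i < m) l i *: v i).
  by rewrite l1 invr1 scale1r; apply; rewrite ltr01.
elim: m vA {l1} => [|m IH] vA; first by rewrite !big_ord0 ltxx.
rewrite !big_ord_recr /=; set L := \sum_(i < m) l i; set S := \sum_(i < m) _.
have L0 : 0 <= L by apply: sumr_ge0.
move=> Ll; have Am : A (v m) by apply: vA.
have [Lz|/eqP Ln] := eqVneq L 0.
  have -> : S = 0.
    apply: big1 => i _; move/eqP: Lz;
      rewrite psumr_eq0 // => /allP/(_ i (mem_index_enum i)).
    by move=> /eqP ->; rewrite scale0r.
  move: Ll; rewrite Lz !add0r => lm.
  by rewrite scalerA mulVf ?scale1r // gt_eqF.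
have Lp : 0 < L by rewrite lt_def L0 andbT; apply/eqP.
have AS : A (L^-1 *: S) by apply: IH => // i im; apply/vA/ltnW.
have -> : (L + l m)^-1 *: (S + l m *: v m) =
    (L / (L + l m)) *: (L^-1 *: S) + (1 - L / (L + l m)) *: v m.
  rewrite scalerA scalerDr scalerA; congr (_ *: _ + _ *: _); field.
    by rewrite (gt_eqF Lp) (gt_eqF Ll).
  by rewrite (gt_eqF Ll).
apply: (convex_setP _).1 => //; first by rewrite divr_ge0 // ltW.
by rewrite ler_pdivrMr // mul1r lerDl.
Qed.

(** Farkas' lemma for the lifts [(v, 1)]: the last coordinate makes the coefficients of a
    nonnegative combination sum to one; failing that, the violating vector splits into [w] and the
    threshold. *)
Lemma separation n (s : seq 'rV[R]_n) (y : 'rV[R]_n) :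
  ~ convex_hull [set` s] y ->
  exists w al, (forall v, v \in s -> dot w v <= al) /\ al < dot w y.
Proof.
pose h (v : 'rV[R]_n) : 'rV[R]_(n + 1) := row_mx v (const_mx 1).
move=> ny; have [gP|] := pselect (forall x, (forall i, (i < size s)%N ->
    dot (h (nth 0 s i)) x <= 0) -> dot (h y) x <= 0).
  have [l l0 yE] := farkas gP; case: ny.
  have -> : y = \sum_(i < size s) l i *: nth 0 s i.
    move/(congr1 lsubmx): yE; rewrite row_mxKl => ->.
    by rewrite linear_sum; apply: eq_bigr => i _; rewrite linearZ /= row_mxKl.
  apply: convex_combination => //; first exact: convex_hull_convex.
    by move=> i il; apply: sub_convex_hull; apply: mem_nth.
  move/(congr1 (fun u => rsubmx u 0 0)): yE; rewrite row_mxKr mxE => ->.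
  rewrite linear_sum summxE; apply: eq_bigr => i _.
  by rewrite linearZ /= row_mxKr !mxE mulr1.
move=> /existsNP[x /not_implyP[sx /negP]]; rewrite -ltNge.
rewrite -[x]hsubmxK in sx *; set w := lsubmx x in sx *.
set b := rsubmx x 0 0; have bE : rsubmx x = const_mx b.
  by apply/rowP => i; rewrite ord1 [RHS]mxE.
rewrite bE in sx *; rewrite dot_row_mx dot_const1 mul1r => yx.
exists w, (- b); split=> [v vs|]; last by rewrite dotC; lra.
have := sx (index v s);
  rewrite index_mem nth_index // dot_row_mx dot_const1 mul1r dotC.
by move=> /(_ vs); lra.
Qed.

(** Closedness without limits: a functional [w] separating [x] leaves a positive gap, while rounding
    changes its value by at most the l1-norm of [w] divided by [N]. *)
Lemma convex_hull_truncn n (s : seq 'rV[R]_n) (x : 'rV[R]_n) :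
  (forall j, 0 <= x 0 j) ->
  (forall N : nat, (0 < N)%N -> convex_hull [set` s]
     (N%:R^-1 *: \row_j (Num.truncn (N%:R * x 0 j))%:R)) ->
  convex_hull [set` s] x.
Proof.
move=> x0 xs; apply: contrapT => /separation[w [al [ws wx]]].
pose W := \sum_j `|w 0 j|; have W0 : 0 <= W by apply: sumr_ge0.
have [N N1 NW] : exists2 N : nat, (0 < N)%N & W < N%:R * (dot w x - al).
  have e0 : 0 < dot w x - al by rewrite subr_gt0.
  exists (Num.bound (W / (dot w x - al))).+1 => //.
  rewrite -ltr_pdivrMr //; apply: lt_le_trans (archi_boundP _) _.
    by rewrite divr_ge0 // ltW.
  by rewrite ler_nat.
have N0 : 0 < N%:R :> R by rewrite ltr0n.
suff : dot w (N%:R^-1 *: \row_j (Num.truncn (N%:R * x 0 j))%:R) <= al.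
  rewrite dotZr -ler_pdivlMl ?invr_gt0 // invrK => fal.
  have : N%:R * dot w x <= dot w (\row_j (Num.truncn (N%:R * x 0 j))%:R) + W.
    rewrite /dot mulr_sumr -big_split; apply: ler_sum => j _ /=.
    rewrite mxE; set t := N%:R * x 0 j; have t0 : 0 <= t by rewrite mulr_ge0.
    have /andP[] := truncn_itv t0; rewrite -natr1 mulrCA -/t => t1 t2.
    rewrite -lerBlDl -mulrBr (le_trans (ler_norm _)) // normrM ler_piMr //.
    by rewrite ger0_norm; lra.
  by move: fal NW; rewrite mulrBr; lra.
have : convex_set [set z | dot w z <= al].
  apply/convex_setP => u v t t0 t1 /= ual val; rewrite dotDr !dotZr.
  have t1' : 0 <= 1 - t by rewrite subr_ge0.
  by have := ler_wpM2l t0 ual; have := ler_wpM2l t1' val; lra.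
move=> /convex_hull_min/(_ ws); apply; exact: xs.
Qed.

End Convexity.

(** [None] stands for the base value 0, which is the maximum over an empty range or over negative
    terms. *)
Lemma bigmax_attained (T : realDomainType) (I : finType) (P : pred I)
    (F : I -> T) :
  exists2 o : option I, (if o is Some i then P i else true) &
    \big[Num.max/0]_(i | P i) F i = if o is Some i then F i else 0.
Proof.
elim/big_ind: _ => [|_ _ [o oP ->] [o' oP' ->]|i Pi]; first by exists None.
- by have [_|_] := leP; [exists o'|exists o].
- by exists (Some i).
Qed.

(** * The order-reversing envelope and the transfer map *)

Section Decomposition.
Variables (T : realDomainType) (d : nat) (le : rel 'I_d)
    (G : simple_graph 'I_d).
Hypotheses (leR : reflexive le) (leT : transitive le).
Implicit Types (y a b : 'rV[T]_d) (C D : {set 'I_d}).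

Definition upmax y j := \big[Num.max/0]_(l | le j l) y 0 l.
Definition posmax y := \big[Num.max/0]_j y 0 j.
Definition deficit y C := \sum_(j in C) (upmax y j - y 0 j).

(* The dilates [t O_P] and [s Q_G] (the latter for perfect [G]). *)
Definition in_order (t : T) a :=
  (forall j, 0 <= a 0 j <= t) /\ (forall i j, le i j -> a 0 j <= a 0 i).

Definition in_stable (s : T) b :=
  (forall j, 0 <= b 0 j) /\
  (forall C, is_clique G C -> \sum_(j in C) b 0 j <= s).

Lemma upmax_ge0 y j : 0 <= upmax y j.
Proof. exact: bigmax_ge_id. Qed.

Lemma upmax_ge y j : y 0 j <= upmax y j.
Proof. by apply: le_bigmax_cond; apply: leR. Qed.

Lemma upmax_anti y i j : le i j -> upmax y j <= upmax y i.
Proof.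
move=> ij; apply/bigmax_leP; split=> [|l jl]; first exact: upmax_ge0.
by apply: le_bigmax_cond; apply: leT jl.
Qed.

Lemma upmax_le_posmax y j : upmax y j <= posmax y.
Proof.
apply/bigmax_leP; split=> [|l _]; first exact: bigmax_ge_id.
exact: le_bigmax.
Qed.

Lemma posmax_ge0 y : 0 <= posmax y.
Proof. exact: bigmax_ge_id. Qed.

Lemma in_stable_ge0 s b : in_stable s b -> 0 <= s.
Proof. by case=> _ /(_ _ (is_clique0 G)); rewrite big_set0. Qed.

(* [upmax y] is the smallest nonnegative order-reversing function above [y], so
   that it may replace [a]. *)
Lemma decomposition t s y : 0 <= t ->
  (exists a b, [/\ in_order t a, in_stable s b & y = a - b]) <->
  posmax y <= t /\ forall C, is_clique G C -> deficit y C <= s.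
Proof.
move=> t0; split=> [[a [b [[a0t amon] [b0 bs] ->]]]|[yt ys]].
  have ub j : upmax (a - b) j <= a 0 j.
    apply/bigmax_leP; split=> [|l jl]; first by case/andP: (a0t j).
    by rewrite !mxE (le_trans _ (amon _ _ jl)) // gerBl.
  split=> [|C /bs]; last first.
    apply: le_trans; apply: ler_sum => j _.
    by rewrite lerBlDr !mxE [b 0 j + _]addrC subrK.
  apply/bigmax_leP; split=> // j _; rewrite !mxE.
  by case/andP: (a0t j) => _; apply: le_trans; rewrite gerBl.
exists (\row_j upmax y j), (\row_j (upmax y j - y 0 j)); split.
- split=> [j|i j ij]; rewrite !mxE; last exact: upmax_anti.
  by rewrite upmax_ge0 (le_trans (upmax_le_posmax y j)).
- split=> [j|C /ys]; first by rewrite mxE subr_ge0 upmax_ge.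
  by rewrite /deficit; under [X in _ -> X <= _]eq_bigr do rewrite mxE.
- by apply/rowP => j; rewrite !mxE subKr.
Qed.

End Decomposition.

(** * Stanley's transfer map and weighted chains *)

Section Transfer.
Variables (d : nat) (le : rel 'I_d) (T : realDomainType).
Hypotheses (leR : reflexive le) (leA : antisymmetric le)
  (leT : transitive le).
Implicit Types (y z : 'rV[T]_d) (C D : {set 'I_d}).

Definition is_chain D := [forall i in D, forall j in D, le i j || le j i].

Definition above_max y j := \big[Num.max/0]_(l | le j l && (l != j)) y 0 l.

Definition transfer y := \row_j (y 0 j - above_max y j).

Lemma upmaxE y j : upmax le y j = Num.max (y 0 j) (above_max y j).
Proof. exact: bigmaxD1. Qed.

Lemma above_max_ge0 y j : 0 <= above_max y j.
Proof. exact: bigmax_ge_id. Qed.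

(** The negative parts of the transferred vector are the terms of the deficit; by the next identity,
    its positive parts are the increments of [upmax] over the values strictly above. *)
Lemma upmax_sub y j : upmax le y j - y 0 j = Num.max 0 (- transfer y 0 j).
Proof. by rewrite mxE opprB upmaxE addr_maxl subrr. Qed.

Lemma upmax_sub_above y j :
  upmax le y j = Num.max 0 (transfer y 0 j) + above_max y j.
Proof. by rewrite mxE addr_maxl add0r subrK upmaxE maxC. Qed.

Lemma strict_above_card i j : le i j -> j != i ->
  (#|[set l | le j l & l != j]| < #|[set l | le i l & l != i]|)%N.
Proof.
move=> ij ji; apply: proper_card; apply/properP; split.
  apply/fintype.subsetP => l; rewrite !inE => /andP[jl lj];
    rewrite (leT ij jl) /=.
  apply: contra lj => /eqP li; rewrite li in jl *.
  by rewrite eq_sym; apply/eqP/leA; rewrite jl ij.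
by exists j; rewrite !inE ?ij ?ji // eqxx andbF.
Qed.

Lemma above_ind (Q : 'I_d -> Prop) :
  (forall j, (forall l, le j l -> l != j -> Q l) -> Q j) -> forall j, Q j.
Proof.
move=> IH j; have [n] := ubnP #|[set l | le j l & l != j]|.
elim: n j => // n IHn j jn; apply: IH => l jl lj; apply: IHn.
exact: leq_trans (strict_above_card jl lj) jn.
Qed.

(** By induction from the top, [above_max y j] only involves coordinates already recovered. *)
Lemma transfer_inj : injective transfer.
Proof.
move=> y y' yy'; apply/rowP; apply: above_ind => j IH.
have := congr1 (fun u : 'rV_d => u 0 j) yy'; rewrite !mxE.
rewrite [above_max y' j](eq_bigr (fun l => y 0 l)) => [|l /andP[jl lj]];
  last first.
  by rewrite IH.
by move/addIr.
Qed.

Lemma transfer_surj z : exists y, transfer y = z.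
Proof.
(* A preimage of [z] is a fixed point of [F]. The iterates from 0 settle at [j] once their number
   exceeds that of the elements strictly above [j], which is less than [d]. *)
pose F y : 'rV[T]_d := \row_j (z 0 j + above_max y j).
have stab : exists n, forall j, iter n.+1 F 0 0 j = iter n F 0 0 j.
  exists d => j.
  suff H n : (#|[set l | le j l & l != j]| < n)%N ->
             iter n.+1 F 0 0 j = iter n F 0 0 j.
    apply: H; rewrite -[X in (_ < X)%N](card_ord d) -cardsT; apply: proper_card.
    by apply/properP; split;
      [apply: finset.subsetT|exists j; rewrite ?inE ?eqxx ?andbF].
  elim: n j => // n IH j jn; rewrite iterS [in RHS]iterS !mxE; congr (_ + _).
  apply: eq_bigr => l /andP[jl lj]; apply: IH.
  exact: leq_trans (strict_above_card jl lj) jn.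
have [n nE] := stab; exists (iter n F 0); apply/rowP => j.
by rewrite mxE -nE iterS mxE addrK.
Qed.

Lemma chain_sub D D' : D' \subset D -> is_chain D -> is_chain D'.
Proof.
move=> /fintype.subsetP sub /forall_inP ch;
  apply/forall_inP => i /sub/ch/forall_inP ci.
by apply/forall_inP => j /sub/ci.
Qed.

(** The minimum is the member of [D] with the most elements strictly above it in the whole poset. *)
Lemma chain_min D i0 : is_chain D -> i0 \in D ->
  exists2 i, i \in D & forall j, j \in D -> le i j.
Proof.
move=> ch i0D; pose up i := #|[set l | le i l & l != i]|.
case: (arg_maxnP up i0D) => i iD imax; exists i => // j jD.
have /forall_inP/(_ j jD)/orP[//|ji] := (forall_inP ch) i iD.
have [->|ij] := eqVneq i j; first exact: leR.
by have : (up j <= up i)%N := imax j jD; rewrite leqNgt strict_above_card.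
Qed.

(** At the minimum [i] of the chain, [upmax le y i] is the positive part at [i] plus
    [above_max y i], and the latter bounds [upmax] on the rest of the chain, so it serves as the
    next [v]. *)
Lemma chain_weight_le y D v : is_chain D -> 0 <= v ->
  (forall j, j \in D -> upmax le y j <= v) ->
  \sum_(j in D) Num.max 0 (transfer y 0 j) <= v.
Proof.
have [n] := ubnP #|D|; elim: n D v => // n IH D v Dn ch v0 Dv.
have [->|[i0 i0D]] := set_0Vmem D; first by rewrite big_set0.
have [i iD imin] := chain_min ch i0D.
rewrite (big_setD1 i) //=; apply: le_trans (Dv i iD).
rewrite upmax_sub_above lerD2l; apply: IH.
- by move: Dn; rewrite (cardsD1 i) iD.
- exact: chain_sub (subsetDl _ _) ch.
- exact: above_max_ge0.
move=> j /setD1P[ji jD]; apply/bigmax_leP; split=> [|l jl];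
  first exact: above_max_ge0.
apply: le_bigmax_cond; rewrite (leT (imin j jD) jl) /=.
apply: contra ji => /eqP li; rewrite li in jl.
by apply/eqP/leA; rewrite jl imin.
Qed.

(** The chain is built greedily: from [j], continue with an element attaining [above_max y j], and
    stop when that maximum is the default 0. *)
Lemma chain_attains y j : exists2 D, is_chain D /\
    (forall i, i \in D -> le j i) &
  upmax le y j <= \sum_(i in D) Num.max 0 (transfer y 0 i).
Proof.
elim/above_ind: j => j IH; rewrite upmax_sub_above.
have [D [Dch Dj] jD] : exists2 D,
    is_chain D /\ (forall i, i \in D -> le j i && (i != j)) &
    above_max y j <= \sum_(i in D) Num.max 0 (transfer y 0 i).
  have [[l /andP[jl lj]|_]] :=
      bigmax_attained (fun l => le j l && (l != j)) (fun l => y 0 l);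
    rewrite /above_max => ->; last first.
    exists finset.set0; last by rewrite big_set0.
    by split=> [|i]; rewrite ?inE //; apply/forall_inP => i; rewrite inE.
  have [D [Dch Dl] lD] := IH l jl lj.
  exists D; last by rewrite (le_trans _ lD) // upmax_ge.
  split=> // i /Dl li; rewrite (leT jl li) /=.
  apply: contra lj => /eqP ij; rewrite ij in li.
  by apply/eqP/leA; rewrite li jl.
have jnD : j \notin D by apply: contraT => /negPn /Dj; rewrite eqxx andbF.
exists (j |: D); last by rewrite big_setU1 //= lerD2l.
split=> [|i /setU1P[->//|/Dj/andP[//]]].
apply/forall_inP => i /setU1P[->|iD]; apply/forall_inP => k /setU1P[->|kD].
- by rewrite leR.
- by have /andP[-> _] := Dj k kD.
- by have /andP[-> _] := Dj i iD; rewrite orbT.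
- by have /forall_inP/(_ i iD)/forall_inP -> := Dch.
Qed.

(** The two preceding bounds express [posmax y] as the largest chain sum of positive parts of the
    transferred vector, which only involves comparability. *)
Lemma posmax_leP y v : 0 <= v ->
  posmax y <= v <->
  forall D, is_chain D -> \sum_(j in D) Num.max 0 (transfer y 0 j) <= v.
Proof.
move=> v0; split=> [yv D Dch|Dv].
  apply: chain_weight_le => // j _.
  exact: le_trans (upmax_le_posmax _ _ _) yv.
apply/bigmax_leP; split=> // j _; have [D [Dch _] jD] := chain_attains y j.
by apply: le_trans (Dv D Dch); apply: le_trans jD; apply: upmax_ge.
Qed.

End Transfer.

Lemma image_enum (I : finType) (V : eqType) (P : pred I) (f : I -> V) :
  [set f x | x in [set x | P x]] = [set` [seq f x | x <- enum P]].
Proof.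
apply/seteqP; split=> [_ [x Px <-]|y /mapP[x]] /=.
  by apply/mapP; exists x; rewrite // mem_enum.
by rewrite mem_enum => Px ->; exists x.
Qed.

(** * Inequality descriptions *)

Section Polytopes.
Variables (R : realType) (d : nat).

Lemma rhoE (X : {set 'I_d}) : rho R X = \row_j (j \in X)%:R.
Proof.
apply/rowP => j; rewrite /rho summxE mxE.
under eq_bigr do rewrite mxE eqxx /=.
by rewrite -natr_sum big_mkcond (bigD1 j) //= eqxx big1 ?addn0 =>
  [|i /negPf nij];
  case: ifP; rewrite // eq_sym nij.
Qed.

Lemma convex_hull_average (n N : nat) (s : seq 'rV[R]_n) (v : nat -> 'rV[R]_n) :
  (0 < N)%N -> (forall i, (i < N)%N -> v i \in s) ->
  convex_hull [set` s] (N%:R^-1 *: \sum_(i < N) v i).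
Proof.
move=> N0 vs; rewrite scaler_sumr.
apply: (@convex_combination _ _ _ _ v (fun=> N%:R^-1)) => [||i|].
- exact: convex_hull_convex.
- by move=> i /vs; apply: sub_convex_hull.
- by rewrite invr_ge0.
- by rewrite sumr_const card_ord -[LHS]mulr_natr mulVf // pnatr_eq0 -lt0n.
Qed.

(** * Scaling and mixing dilates of the two polytopes *)

Section GradedPieces.
Variables (G : simple_graph 'I_d) (le : rel 'I_d).

Lemma in_order_conv s (t1 t2 : R) (a1 a2 : 'rV_d) : 0 <= s -> s <= 1 ->
  in_order le t1 a1 -> in_order le t2 a2 ->
  in_order le (s * t1 + (1 - s) * t2) (s *: a1 + (1 - s) *: a2).
Proof.
move=> s0 s1 [a1t a1m] [a2t a2m]; have s1' : 0 <= 1 - s by rewrite subr_ge0.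
split=> [j|i j ij]; rewrite !mxE; last by rewrite lerD // ler_wpM2l ?a1m ?a2m.
have /andP[? ?] := a1t j; have /andP[? ?] := a2t j.
by rewrite addr_ge0 ?mulr_ge0 //= lerD // ler_wpM2l.
Qed.

Lemma in_stable_conv s (t1 t2 : R) (b1 b2 : 'rV_d) : 0 <= s -> s <= 1 ->
  in_stable G t1 b1 -> in_stable G t2 b2 ->
  in_stable G (s * t1 + (1 - s) * t2) (s *: b1 + (1 - s) *: b2).
Proof.
move=> s0 s1 [b10 b1C] [b20 b2C]; have s1' : 0 <= 1 - s by rewrite subr_ge0.
split=> [j|C cC]; first by rewrite !mxE addr_ge0 ?mulr_ge0.
under eq_bigr do rewrite !mxE.
by rewrite big_split -!mulr_sumr lerD // ler_wpM2l ?b1C ?b2C.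
Qed.

Lemma in_order_scale s t (a : 'rV[R]_d) :
  0 <= s -> in_order le t a -> in_order le (s * t) (s *: a).
Proof.
move=> s0 [at0 am]; split=> [j|i j ij]; rewrite !mxE;
  last by rewrite ler_wpM2l ?am.
by have /andP[? ?] := at0 j; rewrite mulr_ge0 //= ler_wpM2l.
Qed.

Lemma in_stable_scale s t (b : 'rV[R]_d) :
  0 <= s -> in_stable G t b -> in_stable G (s * t) (s *: b).
Proof.
move=> s0 [b0 bC]; split=> [j|C cC]; first by rewrite mxE mulr_ge0.
by under eq_bigr do rewrite mxE; rewrite -mulr_sumr ler_wpM2l ?bC.
Qed.

Lemma in_order_unit t (a : 'rV[R]_d) : 0 <= t -> in_order le t a ->
  exists2 a', in_order le 1 a' & a = t *: a'.
Proof.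
rewrite le_eqVlt => /predU1P[<-|t0] at0; last first.
  exists (t^-1 *: a); last by rewrite scalerA mulfV ?scale1r // gt_eqF.
  have tn0 : t != 0 by rewrite gt_eqF.
  by rewrite -(mulVf tn0); apply: in_order_scale => //; rewrite invr_ge0 ltW.
(* At [t = 0] rescaling is impossible, but the bounds force [a = 0]. *)
exists 0; first by split=> [j|i j _]; rewrite !mxE ?lexx ?ler01.
by apply/rowP => j; case: at0 => /(_ j) at0 _; rewrite scale0r mxE;
  apply/le_anti; rewrite andbC.
Qed.

Lemma in_stable_unit s (b : 'rV[R]_d) : 0 <= s -> in_stable G s b ->
  exists2 b', in_stable G 1 b' & b = s *: b'.
Proof.
rewrite le_eqVlt => /predU1P[<-|s0] b0; last first.
  exists (s^-1 *: b); last by rewrite scalerA mulfV ?scale1r // gt_eqF.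
  have sn0 : s != 0 by rewrite gt_eqF.
  by rewrite -(mulVf sn0); apply: in_stable_scale => //; rewrite invr_ge0 ltW.
exists 0; first by split=> [j|C _]; rewrite ?mxE ?big1 ?ler01 // => j _;
  rewrite mxE.
apply/rowP => j; case: b0 => b0 bC; rewrite scale0r mxE; apply/le_anti;
  rewrite b0 andbT.
by have := bC _ (is_clique1 G j); rewrite big_set1.
Qed.

(* Both [Gamma] ([e = 0]) and the join ([e] the last basis vector) are of this
   form. *)
Lemma dilate_hull_graded m (e : 'rV[R]_m)
    (f g : {linear 'rV[R]_d -> 'rV[R]_m}) k v :
  dilate k.+1 (convex_hull ([set e + f a | a in [set a | in_order le 1 a]] `|`
                            [set g b | b in [set b | in_stable G 1 b]])) v <->
  exists t a b,
    [/\ 0 <= t <= k.+1%:R, in_order le t a, in_stable G (k.+1%:R - t) b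
      & v = t *: e + f a + g b].
Proof.
set H := _ `|` _.
have k0 : 0 < k.+1%:R :> R by rewrite ltr0n.
have io : in_order le 1 (0 : 'rV[R]_d) by split=> [j|i j _];
  rewrite !mxE ?lexx ?ler01.
have is0 : in_stable G 1 (0 : 'rV[R]_d).
  by split=> [j|C _]; rewrite ?mxE ?big1 ?ler01 // => j _; rewrite mxE.
suff HE : convex_hull H = [set v | exists t a b, [/\ 0 <= t <= 1,
    in_order le t a, in_stable G (1 - t) b & v = t *: e + f a + g b]].
  rewrite HE; split=> [[_ [t [a [b [/andP[t0 t1] at0 b0 ->]]]] <-]|].
    exists (k.+1%:R * t), (k.+1%:R *: a), (k.+1%:R *: b); split.
    - by rewrite mulr_ge0 ?(ltW k0) //= ler_piMr // ltW.
    - by apply: in_order_scale; rewrite // ltW.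
    - by rewrite -[X in X - _]mulr1 -mulrBr; apply: in_stable_scale;
      rewrite // ltW.
    - by rewrite !scalerDr scalerA !linearZ.
  move=> [t [a [b [/andP[t0 t1] at0 b0 ->]]]].
  have kn0 : k.+1%:R != 0 :> R by rewrite pnatr_eq0.
  have ki : 0 <= k.+1%:R^-1 :> R by rewrite invr_ge0 ltW.
  exists (k.+1%:R^-1 *: (t *: e + f a + g b));
    last by rewrite scalerA mulfV ?scale1r // gt_eqF.
  exists (k.+1%:R^-1 * t), (k.+1%:R^-1 *: a), (k.+1%:R^-1 *: b); split.
  - by rewrite mulr_ge0 //= mulrC ler_pdivrMr // mul1r.
  - exact: in_order_scale.
  - rewrite -[X in X - _](mulVf kn0) -mulrBr.
    exact: in_stable_scale.
  - by rewrite !scalerDr scalerA !linearZ.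
apply/seteqP; split.
  apply: convex_hull_min.
    apply/convex_setP => _ _ s s0 s1 [t1 [a1 [b1 [/andP[t10 t11] at1 bt1 ->]]]]
      [t2 [a2 [b2 [/andP[t20 t21] at2 bt2 ->]]]].
    exists (s * t1 + (1 - s) * t2), (s *: a1 + (1 - s) *: a2),
      (s *: b1 + (1 - s) *: b2).
    have s1' : 0 <= 1 - s by rewrite subr_ge0.
    split; first by rewrite addr_ge0 ?mulr_ge0 //=; nra.
    - exact: in_order_conv.
    - rewrite [X in in_stable _ X](_ : _ = s * (1 - t1) + (1 - s) * (1 - t2));
      last by ring.
      exact: in_stable_conv.
    - have -> : f (s *: a1 + (1 - s) *: a2) = s *: f a1 + (1 - s) *: f a2.
        by rewrite linearD !linearZ.
      have -> : g (s *: b1 + (1 - s) *: b2) = s *: g b1 + (1 - s) *: g b2.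
        by rewrite linearD !linearZ.
      rewrite !scalerDr !scalerA [in RHS](scalerDl e).
      by rewrite addrACA; congr (_ + _); rewrite addrACA.
  move=> _ [[a at0 <-]|[b bt0 <-]].
    exists 1, a, 0; split; rewrite ?lexx ?ler01 //;
      last by rewrite scale1r linear0 addr0.
    by have := in_stable_scale (lexx 0) is0; rewrite mul0r scale0r subrr.
  exists 0, 0, b; split; rewrite ?lexx ?ler01 ?subr0 //.
    by have := in_order_scale (lexx 0) io; rewrite mul0r scale0r.
  by rewrite scale0r linear0 !add0r.
move=> _ [t [a [b [/andP[t0 t1] at0 b0 ->]]]].
(* With [a = t a'] and [b = (1 - t) b'] the point is a convex combination of one generator of each
   kind. *)
have [a' a1 ->] := in_order_unit t0 at0.
have s0 : 0 <= 1 - t by rewrite subr_ge0.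
have [b' b1 ->] := in_stable_unit s0 b0.
rewrite !linearZ /= -scalerDr;
  apply: ((convex_setP _).1 (@convex_hull_convex R m H)) => //.
- by apply: sub_convex_hull; left; exists a'.
- by apply: sub_convex_hull; right; exists b'.
Qed.

Lemma convex_in_order (t : R) : convex_set [set a : 'rV[R]_d | in_order le t a].
Proof.
apply/convex_setP => a1 a2 s s0 s1 a1t a2t.
have -> : t = s * t + (1 - s) * t by ring.
exact: in_order_conv.
Qed.

Lemma convex_in_stable (t : R) :
  convex_set [set b : 'rV[R]_d | in_stable G t b].
Proof.
apply/convex_setP => b1 b2 s s0 s1 b1t b2t.
have -> : t = s * t + (1 - s) * t by ring.
exact: in_stable_conv.
Qed.

End GradedPieces.

(** Clique inequalities survive rounding down: the floors of [N b] have clique sums at most [N], so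
    [N] stable sets cover them, and the approximant is the average of their indicator vectors. *)
Lemma stable_set_polytopeE (G : simple_graph 'I_d) : is_perfect G ->
  @stable_set_polytope R d G = [set b | in_stable G 1 b].
Proof.
move=> pG; rewrite /stable_set_polytope image_enum; set s := map _ _.
apply/seteqP; split.
  apply: convex_hull_min; first exact: convex_in_stable.
  move=> v /mapP[S]; rewrite mem_enum => Sst ->; rewrite rhoE.
  split=> [j|C cC]; first by rewrite mxE.
  under eq_bigr do rewrite mxE.
  by rewrite -natr_sum sum_mem lern1; apply: (card_clique_stable cC).
move=> b [b0 bC]; apply: convex_hull_truncn => // N N0.
have [|u [uN ust uE]] :=
  @perfect_weighted_cover _ _ (fun j => Num.truncn (N%:R * b 0 j)) N pG.
  move=> C cC; rewrite -(ler_nat R) natr_sum.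
  have := ler_wpM2l (ler0n R N) (bC C cC); rewrite mulr1; apply: le_trans.
  by rewrite mulr_sumr; apply: ler_sum => j _; rewrite truncn_le mulr_ge0.
rewrite [X in _ *: X](_ : _ = \sum_(i < N) rho R (nth finset.set0 u i)).
  apply: (convex_hull_average (v := fun i => rho R (nth finset.set0 u i))) =>
    // i iN.
  rewrite map_f // mem_enum.
  by apply: (allP ust); rewrite mem_nth // uN.
apply/rowP => j; rewrite mxE -uE /cover_mult summxE natr_sum
  (big_nth finset.set0) uN big_mkord.
by apply: eq_bigr => i _; rewrite rhoE mxE.
Qed.

(** A layer-cake decomposition: the superlevel sets of the rounded function [N a] are ideals, and
    the approximant is the average of their indicator vectors. *)
Lemma order_polytopeE (disp : Order.disp_t) (P : finPOrderType disp)
    (p : 'I_d -> P) :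
  bijective p ->
  @order_polytope R d disp P p =
    [set a | in_order (fun i j => p i <= p j)%O 1 a].
Proof.
case=> q pK qK; rewrite /order_polytope image_enum; set s := map _ _.
apply/seteqP; split.
  apply: convex_hull_min; first exact: convex_in_order.
  move=> v /mapP[I]; rewrite mem_enum => Iid ->; rewrite rhoE.
  split=> [j|i j ij]; rewrite !mxE; first by rewrite ler0n lern1 leq_b1.
  rewrite ler_nat !inE; case: (boolP (p j \in I)) => // pj.
  by have /forall_inP/(_ _ pj)/forallP/(_ (p i))/implyP -> := Iid.
move=> a [a01 am]; apply: convex_hull_truncn => [j|N N0];
  first by case/andP: (a01 j).
pose X i := [set x : P | (i < Num.truncn (N%:R * a 0 (q x) : R)%R)%N]%SET.
rewrite [X in _ *: X](_ : _ = \sum_(i < N) rho R (p @^-1: X i)).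
  apply: (convex_hull_average (v := fun i => rho R (p @^-1: X i))) => // i iN.
  apply/mapP; exists (X i) => //; rewrite mem_enum.
  apply/forall_inP => x /[!inE] ix; apply/forallP => y; apply/implyP => yx;
    rewrite inE.
  apply: leq_trans ix _; apply: le_truncn; rewrite ler_wpM2l // am //.
  by rewrite !qK.
apply/rowP => j; rewrite mxE summxE; under eq_bigr do rewrite rhoE mxE !inE pK.
set m := Num.truncn _; have mN : (m <= N)%N.
  have /andP[aj0 aj1] := a01 j.
  rewrite -(ler_nat R) (le_trans (y := N%:R * a 0 j)) //.
    by rewrite truncn_le mulr_ge0.
  by rewrite ler_piMr.
(* Index [j] belongs to exactly the levels [i < m]. *)
rewrite -natr_sum; congr _%:R.
by rewrite -(subnKC mN) big_split_ord /= (eq_bigr (fun=> 1%N)) ?sum1_card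
  ?card_ord ?big1 ?addn0 // => i _;
  rewrite ?ltn_ord // ltnNge leq_addr.
Qed.

End Polytopes.

Definition converse (T : Type) (r : rel T) : rel T := fun x y => r y x.

(** * Inequalities for the dilates of [Gamma] and of the join *)

Section Descriptions.
Variables (R : realType) (d : nat) (G : simple_graph 'I_d) (le : rel 'I_d).
Hypotheses (leR : reflexive le) (leT : transitive le).

Let OP := [set a : 'rV[R]_d | in_order le 1 a].
Let QG := [set b : 'rV[R]_d | in_stable G 1 b].

(** By [decomposition], membership asks for a [t] with [posmax x <= t] and all deficits at most
    [k.+1 - t]; the best choice is [t = posmax x]. *)
Lemma dilate_Gamma k x : dilate k.+1 (Gamma OP QG) x <->
  forall C, is_clique G C -> posmax x + deficit le x C <= k.+1%:R.
Proof.
have -> : Gamma OP QG =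
  convex_hull ([set 0 + idfun a | a in OP] `|` [set - b | b in QG]).
  by congr (convex_hull (_ `|` _)); apply/seteqP; split=> [a Oa|_ [a Oa <-]];
    [exists a; rewrite // add0r|rewrite add0r].
apply: iff_trans (@dilate_hull_graded R d G le d 0 idfun -%R k x) _; split.
  move=> [t [a [b [/andP[t0 tk] at0 b0]]]]; rewrite scaler0 add0r /= => xE.
  have [|xt xk C /xk] := (decomposition G leR leT (k.+1%:R - t) x t0).1.
    by exists a, b.
  by move: xt; lra.
move=> xk; have xk0 : posmax x <= k.+1%:R.
  by have := xk _ (is_clique0 G); rewrite /deficit big_set0 addr0.
exists (posmax x).
have [|a [b [ax bx xE]]] :=
    (decomposition G leR leT (k.+1%:R - posmax x) x (posmax_ge0 x)).2.
  by split=> // C /xk; lra.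
by exists a, b; split; rewrite // ?posmax_ge0 // scaler0 add0r.
Qed.

(* The shear [(x, t) |-> (t - x, t)] turns the join into the union of the
   [t O_P' - (k - t) Q_G], where [P'] is the dual poset. *)
Lemma dilate_join k x t (y := const_mx t - x) :
  dilate k.+1 (join_polytope OP QG) (row_mx x (const_mx t)) <->
  posmax y <= t /\
  forall C, is_clique G C -> deficit (converse le) y C <= k.+1%:R - t.
Proof.
have ge_refl : reflexive (converse le) by move=> i; apply: leR.
have ge_trans : transitive (converse le) by move=> j i l ji lj;
  apply: leT lj ji.
pose i0 : 'M[R]_(d, d + 1) := row_mx 1%:M 0.
have i0E (z : 'rV_d) : z *m i0 = row_mx z 0 by rewrite mul_mx_row mulmx1 mulmx0.
pose e : 'rV[R]_(d + 1) := row_mx 0 (const_mx 1).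
have -> : join_polytope OP QG =
    convex_hull ([set e + mulmxr i0 a | a in OP] `|`
      [set mulmxr i0 b | b in QG]).
  congr (convex_hull (_ `|` _)); apply: eq_imagel => a _ /=; rewrite i0E //.
  by rewrite add_row_mx add0r addr0.
apply: iff_trans (@dilate_hull_graded R d G le _ e (mulmxr i0) (mulmxr i0) k _)
  _.
have rowE t' (a b : 'rV_d) : t' *: e + mulmxr i0 a + mulmxr i0 b =
  row_mx (a + b) (const_mx t').
  rewrite /= !i0E /e scale_row_mx !add_row_mx scaler0 add0r !addr0.
  by congr row_mx; apply/rowP => j; rewrite !mxE mulr1.
(* The reflection [a -> s - a] exchanges the order-reversing functions of a poset and of its
   dual. *)
have revP s a : in_order le s a <-> in_order (converse le) s (const_mx s - a).
  split=> -[a0 am]; split=> [j|i j ij].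
  - by have := a0 j; rewrite !mxE; lra.
  - by rewrite !mxE lerD2l lerN2 am.
  - by have := a0 j; rewrite !mxE; lra.
  - by have := am _ _ ij; rewrite !mxE lerD2l lerN2.
split.
  move=> [t' [a [b [/andP[t0 tk] at0 b0]]]]; rewrite rowE => /eq_row_mx[xE tE].
  have {}tE : t' = t by have := congr1 (fun u : 'rV_1 => u 0 0) tE;
    rewrite !mxE.
  rewrite {t'}tE in t0 tk at0 b0.
  apply/(decomposition G ge_refl ge_trans _ _ t0).
  exists (const_mx t - a), b; split=> //; first exact/revP.
  by rewrite /y xE opprD addrA.
move=> [yt yk]; have t0 : 0 <= t := le_trans (posmax_ge0 y) yt.
have [|a [b [ay bx yE]]] :=
  (decomposition G ge_refl ge_trans (k.+1%:R - t) y t0).2; first by [].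
exists t, (const_mx t - a), b; split=> //.
- by rewrite t0 -subr_ge0 (in_stable_ge0 bx).
- by apply/revP; rewrite subKr.
- by rewrite rowE; congr row_mx;
  rewrite -addrA [- a + b]addrC -opprB -yE /y subKr.
Qed.

End Descriptions.

(** * Lattice points *)

Section Counting.
Variables (d : nat) (G : simple_graph 'I_d).
Implicit Types (le : rel 'I_d).

Definition card_set (T : choiceType) (A : set T) : nat := #|` fset_set A|.

Lemma card_set_image (T U : choiceType) (f : T -> U) (A : set T) :
  finite_set A -> injective f -> card_set (f @` A) = card_set A.
Proof. by move=> Afin finj;
  rewrite /card_set fset_set_image // card_imfset. Qed.

Lemma card_setU_disj (T : choiceType) (A B : set T) :
  finite_set A -> finite_set B -> A `&` B = set0 ->
  card_set (A `|` B) = (card_set A + card_set B)%N.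
Proof.
move=> Afin Bfin AB0; rewrite /card_set fset_setU // cardfsU -fset_setI // AB0.
by rewrite fset_set0 cardfs0 subn0.
Qed.

Definition gamma_points le k : set 'rV[int]_d :=
  [set y | forall C, is_clique G C -> posmax y + deficit le y C <= k%:Z].

(* In the sheared coordinates [(t - x, t)]. *)
Definition join_points le k : set ('rV[int]_d * int) :=
  [set yt | posmax yt.1 <= yt.2 /\
            forall C, is_clique G C -> deficit le yt.1 C <= k%:Z - yt.2].

Definition chain_clique_points le k : set 'rV[int]_d :=
  [set z | forall D C, is_chain le D -> is_clique G C ->
     \sum_(j in D) Num.max 0 (z 0 j) + \sum_(j in C) Num.max 0 (- z 0 j) <=
       k%:Z].

Lemma finite_box (k : nat) :
  finite_set [set z : 'rV[int]_d | forall j, `|z 0 j| <= k%:Z].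
Proof.
pose f (u : 'rV['I_(k + k).+1]_d) : 'rV[int]_d := \row_j ((u 0 j)%:Z - k%:Z).
apply: (@sub_finite_set _ _ (range f)); last exact/finite_image/finite_finset.
move=> z zk; exists (\row_j inord (absz (z 0%R j + k%:Z))) => //.
by apply/rowP => j; rewrite !mxE inordK; have := zk j; lia.
Qed.

Section Posets.
Variable le : rel 'I_d.
Hypotheses (leR : reflexive le) (leA : antisymmetric le)
  (leT : transitive le).

Lemma is_chain_converse D : is_chain (converse le) D = is_chain le D.
Proof.
by apply: eq_forallb_in => i _; apply: eq_forallb_in => j _; rewrite orbC.
Qed.

(** The empty clique bounds [y 0 j] from above, the singleton clique of [j] from below. *)
Lemma gamma_points_le k y j : gamma_points le k y -> `|y 0 j| <= k%:Z.
Proof.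
move=> yk; have := yk _ (is_clique1 G j); have := yk _ (is_clique0 G).
rewrite /deficit big_set0 big_set1 addr0.
have : y 0 j <= posmax y by exact: le_bigmax.
by have := posmax_ge0 y; have := upmax_ge0 le y j; rewrite ler_norml; lra.
Qed.

Lemma finite_gamma_points k : finite_set (gamma_points le k).
Proof. by apply: sub_finite_set (finite_box k) => y yk j;
  apply: gamma_points_le. Qed.

Lemma transfer_gamma_points k :
  @transfer d le int @` gamma_points le k = chain_clique_points le k.
Proof.
have defE y C : deficit le y C = \sum_(j in C) Num.max 0 (- transfer le y 0 j).
  by apply: eq_bigr => j _; rewrite upmax_sub.
apply/seteqP; split=> [_ [y yk <-] D C Dch Ccl|z zk].
  rewrite -lerBrDr -defE; have := yk C Ccl; rewrite -lerBrDr => yv.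
  apply: (posmax_leP leR leA leT y _).1 => //.
  exact: le_trans (posmax_ge0 y) yv.
have [y yz] := transfer_surj leA leT z; exists y => // C Ccl.
rewrite -lerBrDr defE yz; apply/(posmax_leP leR leA leT).
  (* The empty chain shows that the threshold left for [posmax y] is nonnegative. *)
  have := zk finset.set0 C; rewrite big_set0 add0r subr_ge0; apply=> //.
  by apply/forall_inP => i; rewrite inE.
by move=> D Dch; rewrite yz lerBrDr zk.
Qed.

Lemma card_gamma_points k :
  card_set (gamma_points le k) = card_set (chain_clique_points le k).
Proof.
rewrite -transfer_gamma_points card_set_image //;
  first exact: finite_gamma_points.
exact: transfer_inj.
Qed.

Lemma gamma_points0 : gamma_points le 0 = [set 0].
Proof.
apply/seteqP; split=> [y yk|y ->] /=.
  apply/rowP => j; apply/eqP; rewrite mxE -normr_le0.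
  exact: gamma_points_le yk.
have max0 (Q : pred 'I_d) : \big[Num.max/0]_(l | Q l) (0 : 'rV[int]_d) 0 l = 0.
  by apply: big1_idem => [|l _]; rewrite ?maxxx // mxE.
move=> C _; rewrite /posmax max0 add0r /deficit big1 // => j _.
by rewrite /upmax max0 mxE subrr.
Qed.

Lemma join_points0 : join_points le 0 = [set (y, 0) | y in gamma_points le 0].
Proof.
rewrite gamma_points0; apply/seteqP; split=> [[y t] [/= yt yk]|].
  have := yk _ (is_clique0 G); rewrite /deficit big_set0 /= => t0.
  have {t0} tE : t = 0 by have := le_trans (posmax_ge0 y) yt; lra.
  exists y; last by rewrite tE.
  suff : gamma_points le 0 y by rewrite gamma_points0.
  move=> C /yk /=; move: yt; rewrite tE; lra.
move=> _ [y -> <-]; have : gamma_points le 0 0 by rewrite gamma_points0.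
move=> y0; split=> [|C /y0] /=; last by have := posmax_ge0 (0 : 'rV[int]_d);
  lra.
by have := y0 _ (is_clique0 G); rewrite /deficit big_set0 addr0.
Qed.

(** If [posmax y < t], integrality allows lowering [t] and [k] together, which keeps [k - t]; if
    [t = posmax y], what remains is the condition of [gamma_points]. *)
Lemma join_pointsS k :
  join_points le k.+1 = [set (yt.1, yt.2 + 1) | yt in join_points le k] `|`
                        [set (y, posmax y) | y in gamma_points le k.+1].
Proof.
have kE : k.+1%:Z = k%:Z + 1 by rewrite -addn1 PoszD.
apply/seteqP; split=> [[y t] [/= yt yk]|_ [[[y t] [/= yt yk]]|[y yk]] <-].
- move: yt; rewrite le_eqVlt => /predU1P[tE|yt]; [right|left].
    by exists y; [move=> C /yk; lra|rewrite tE].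
  exists (y, t - 1); last by rewrite /= subrK.
  by split=> [|C /yk] /=; [rewrite lerBrDr lezD1|rewrite kE; lra].
- by split=> [|C /yk] /=; [lra|rewrite kE; lra].
- by split=> [|C /yk] /=; [|lra].
Qed.

Lemma finite_join_points k : finite_set (join_points le k).
Proof.
elim: k => [|k IH]; first by rewrite join_points0;
  apply/finite_image/finite_gamma_points.
by rewrite join_pointsS finite_setU; split; apply: finite_image => //;
  apply: finite_gamma_points.
Qed.

Lemma card_join_points0 : card_set (join_points le 0) = 1%N.
Proof. by rewrite join_points0 gamma_points0 image_set1 /card_set fset_set1
  cardfs1. Qed.

Lemma card_join_pointsS k :
  card_set (join_points le k.+1) =
  (card_set (join_points le k) + card_set (gamma_points le k.+1))%N.
Proof.
rewrite join_pointsS card_setU_disj.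
- congr (_ + _)%N; apply: card_set_image.
  + exact: finite_join_points.
  + by move=> [y t] [y' t'] [<- /addIr ->].
  + exact: finite_gamma_points.
  + by move=> y y' [].
- exact/finite_image/finite_join_points.
- exact/finite_image/finite_gamma_points.
(* A raised point has its last coordinate strictly above [posmax y]. *)
- rewrite -subset0 => _ [[[y t] [/= yt _] <-] [y' _ [yE tE]]].
  by move: tE; rewrite yE; lra.
Qed.

End Posets.

(** After the transfer, the order enters only through its chains, which are also the chains of the
    dual. *)
Lemma card_gamma_points_converse le k :
  reflexive le -> antisymmetric le -> transitive le ->
  card_set (gamma_points (converse le) k) = card_set (gamma_points le k).
Proof.
move=> lr la lt; rewrite !card_gamma_points //.
- congr card_set; apply/seteqP; split=> z zk D C Dch; apply: zk.
    by rewrite is_chain_converse.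
  by rewrite -is_chain_converse.
- by move=> i j; rewrite andbC => /la.
- by move=> j i l ji lj; apply: lt lj ji.
Qed.

End Counting.

(** The hypothesis makes the Ehrhart series of [B] equal to [1 - X] times that of [A], and this is
    the additional factor contributed by the larger dimension of [A]. *)
Lemma delta_coef_suspension (R : realType) n (A : set 'rV[R]_(n + 1))
    (B : set 'rV[R]_n) :
  (forall k, ehrhart_coef A k.+1 = ehrhart_coef A k + ehrhart_coef B k.+1) ->
  forall k, delta_coef A k = delta_coef B k.
Proof.
move=> AB k.
(* Terms of degree above [k] do not affect the coefficient, so truncated series suffice. *)
have deltaE m (C : set 'rV[R]_m) : delta_coef C k =
    ((1 - 'X : {poly int}) ^+ m.+1 * \poly_(i < k.+1) ehrhart_coef C i)`_k.
  rewrite coefM; apply: eq_bigr => i _.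
  by rewrite coef_poly ltnS leq_subr.
have expS : (1 - 'X : {poly int}) ^+ (n + 1).+1 = (1 - 'X) ^+ n.+1 * (1 - 'X).
  by rewrite addn1 exprSr.
have AB0 : ehrhart_coef A 0 = ehrhart_coef B 0 by [].
rewrite !deltaE expS;
  move: (ehrhart_coef A) (ehrhart_coef B) AB AB0 => eA eB AB AB0.
rewrite -mulrA !coefM; apply: eq_bigr => i _; congr (_ * _).
rewrite mulrBl mul1r coefB coefXM !coef_poly ltnS leq_subr.
case: (k - i)%N (leq_subr i k) => [|j] jk /=; first by rewrite subr0.
by rewrite ltnS (ltnW jk) // AB addrC addKr.
Qed.

(** * From real polytopes to integer point counts *)

Section LatticeCounts.
Variables (R : realType) (d : nat) (G : simple_graph 'I_d) (le : rel 'I_d).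
Hypotheses (leR : reflexive le) (leA : antisymmetric le)
  (leT : transitive le).

Let OP := [set a : 'rV[R]_d | in_order le 1 a].
Let QG := [set b : 'rV[R]_d | in_stable G 1 b].

Lemma intr_bigmax (I : finType) (P : pred I) (F : I -> int) :
  (\big[Num.max/0]_(i | P i) F i)%:~R =
    \big[Num.max/0]_(i | P i) (F i)%:~R :> R.
Proof.
apply: (big_morph intr) => // a b.
by rewrite !maxElt ltr_int; case: ifP.
Qed.

Lemma posmax_lattice (y : 'rV[int]_d) :
  posmax (lattice_vec R y) = (posmax y)%:~R.
Proof. by rewrite intr_bigmax; apply: eq_bigr => j _; rewrite mxE. Qed.

Lemma deficit_lattice (r : rel 'I_d) (y : 'rV[int]_d) C :
  deficit r (lattice_vec R y) C = (deficit r y C)%:~R.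
Proof.
rewrite rmorph_sum; apply: eq_bigr => j _; rewrite rmorphB /= mxE;
  congr (_ - _).
by rewrite intr_bigmax; apply: eq_bigr => l _; rewrite mxE.
Qed.

Lemma lattice_vec_inj n : injective (@lattice_vec R n).
Proof.
move=> x y xy; apply/rowP => j; apply: (@intr_inj R).
by have := congr1 (fun u : 'rV[R]_n => u 0 j) xy; rewrite !mxE.
Qed.

Lemma lattice_count_Gamma k :
  lattice_count (dilate k.+1 (Gamma OP QG)) = card_set (gamma_points G le k.+1).
Proof.
rewrite -(card_set_image (finite_gamma_points G le k.+1) (@lattice_vec_inj d)).
congr card_set; apply/seteqP; split=> [v [+ [y _ yE]]|v [y yk <-]].
  rewrite -yE => /(dilate_Gamma G leR leT) yk; exists y => // C /yk.
  by rewrite posmax_lattice deficit_lattice -intrD -(ler_int R).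
split; last by exists y.
apply/(dilate_Gamma G leR leT) => C /yk.
by rewrite posmax_lattice deficit_lattice -intrD -(ler_int R).
Qed.

Lemma lattice_count_join k :
  lattice_count (dilate k.+1 (join_polytope OP QG)) =
  card_set (join_points G (converse le) k.+1).
Proof.
pose f (yt : 'rV[int]_d * int) : 'rV[int]_(d + 1) :=
  row_mx (const_mx yt.2 - yt.1) (const_mx yt.2).
have finj : injective f.
  move=> [y t] [y' t'] /eq_row_mx /= [yE tE].
  have {}tE : t = t' by have := congr1 (fun u : 'rV_1 => u 0 0) tE;
    rewrite !mxE.
  by move: yE; rewrite tE => /addrI/oppr_inj ->.
have fE y t : lattice_vec R (f (y, t)) =
    row_mx (const_mx t%:~R - lattice_vec R y) (const_mx t%:~R).
  by rewrite /lattice_vec /f map_row_mx map_mxB !map_const_mx.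
have ptP y t : dilate k.+1 (join_polytope OP QG) (lattice_vec R (f (y, t))) <->
    join_points G (converse le) k.+1 (y, t).
  rewrite fE; apply: iff_trans (dilate_join G leR leT _ _ _) _.
  rewrite subKr posmax_lattice ler_int; split=> -[yt yk]; split=> // C /yk.
    by rewrite deficit_lattice -[k.+1%:R]/(k.+1%:Z%:~R) -intrB ler_int.
  by rewrite deficit_lattice -[k.+1%:R]/(k.+1%:Z%:~R) -intrB ler_int.
have fin := finite_join_points G (converse le) k.+1.
rewrite -(card_set_image fin (inj_comp (@lattice_vec_inj _) finj)).
congr card_set; apply/seteqP; split=> [v [+ [z _ zE]]|v [[y t] yt <-]].
  rewrite -zE.
  (* The inverse of the shear is integral as well, so every lattice point is reached. *)
  have -> : z = f (const_mx (z 0 (rshift d 0)) - lsubmx z, z 0 (rshift d 0)).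
    rewrite /f /= subKr -[LHS]hsubmxK; congr row_mx; apply/rowP => j.
    by rewrite !mxE ord1.
  by move/ptP => yt; eexists; first exact: yt.
by split; [apply/ptP|exists (f (y, t))].
Qed.

Lemma delta_coef_join_Gamma k :
  delta_coef (join_polytope OP QG) k = delta_coef (Gamma OP QG) k.
Proof.
apply: delta_coef_suspension => {}k.
(* At [k = 0] the coefficient is 1 by convention, matching the single element of [join_points]. *)
have -> : ehrhart_coef (join_polytope OP QG) k =
    (card_set (join_points G (converse le) k))%:Z.
  case: k => [|k]; first by rewrite card_join_points0.
  by rewrite /ehrhart_coef lattice_count_join.
rewrite /ehrhart_coef lattice_count_join lattice_count_Gamma.
by rewrite card_join_pointsS // card_gamma_points_converse.
Qed.

End LatticeCounts.

(** * Reflexivity *)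

Section LatticePolytopes.
Variable R : realType.

Lemma lattice_polytope_image m n (f : 'rV[R]_m -> 'rV[R]_n)
    (fz : 'rV[int]_m -> 'rV[int]_n) A :
  affine_map f -> (forall z, f (lattice_vec R z) = lattice_vec R (fz z)) ->
  lattice_polytope A -> lattice_polytope (f @` A).
Proof.
move=> faff fE [s ->]; exists (map fz s); rewrite -convex_hull_image //.
congr convex_hull; apply/seteqP;
  split=> [v [w [z zs <-] <-]|v [w /mapP[z zs ->] <-]].
  by exists (fz z); [apply: map_f|rewrite fE].
by exists (lattice_vec R z); [exists z|rewrite fE].
Qed.

Lemma lattice_polytopeU n (A B : set 'rV[R]_n) :
  lattice_polytope A -> lattice_polytope B ->
    lattice_polytope (convex_hull (A `|` B)).
Proof.
move=> [s ->] [s' ->]; exists (s ++ s'); rewrite convex_hullU -image_setU.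
by congr (convex_hull (_ @` _)); apply/seteqP; split=> z /=;
  rewrite mem_cat => /orP.
Qed.

Lemma lattice_polytope_join d (A B : set 'rV[R]_d) :
  lattice_polytope A -> lattice_polytope B ->
    lattice_polytope (join_polytope A B).
Proof.
have aff (c : R) : affine_map (fun x : 'rV[R]_d =>
  row_mx x (const_mx c : 'rV_1)).
  move=> t x y; rewrite !scale_row_mx add_row_mx; congr row_mx.
  by apply/rowP => j; rewrite !mxE; ring.
move=> Al Bl; apply: lattice_polytopeU.
  apply: (lattice_polytope_image (fz := fun z =>
    row_mx z (const_mx 1)) (aff 1)) => // z.
  by rewrite /lattice_vec map_row_mx map_const_mx rmorph1.
apply: (lattice_polytope_image (fz := fun z => row_mx z (const_mx 0)) (aff 0))
  => // z.
by rewrite /lattice_vec map_row_mx map_const_mx rmorph0.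
Qed.

Lemma lattice_polytope_rho d (I : finType) (P : pred I) (X : I -> {set 'I_d}) :
  lattice_polytope (convex_hull [set rho R (X i) | i in [set i | P i]]).
Proof.
exists [seq \row_j (j \in X i)%:R | i <- enum P]; congr convex_hull.
rewrite -image_enum image_comp; apply: eq_imagel => i _ /=.
by rewrite rhoE; apply/rowP => j; rewrite !mxE rmorph_nat.
Qed.

Variable n : nat.

(** The dual is the hull of 0 and the normals: a point outside it is separated by some [w], a
    positive multiple of which lies in [B] and pairs with the point to more than one. *)
Lemma polar_dual_halfspaces (s : seq 'rV[int]_n) (B : set 'rV[R]_n) :
  (forall z, B z <-> forall u, u \in s -> dot (lattice_vec R u) z <= 1) ->
  lattice_polytope (polar_dual B).
Proof.
move=> BE; exists (0 :: s).
have lv0 : lattice_vec R (0 : 'rV[int]_n) = 0 by apply/rowP => j; rewrite !mxE.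
apply/seteqP; split=> y; last first.
  move: y; apply: convex_hull_min.
    apply/convex_setP => u v t t0 t1 uB vB z zB; rewrite dotDl !dotZl.
    have t1' : 0 <= 1 - t by rewrite subr_ge0.
    by have := ler_wpM2l t0 (uB z zB); have := ler_wpM2l t1' (vB z zB); lra.
  move=> v [u us <-] z /BE zu; move: us; rewrite /= inE => /predU1P[->|/zu //].
  by rewrite lv0 dot0l ler01.
have -> : [set lattice_vec R z | z in [set` 0 :: s]] =
    [set` map (@lattice_vec R n) (0 :: s)].
  by apply/seteqP; split=> [v [u us <-]|v /mapP[u us ->]];
    [apply: map_f|exists u].
move=> yB; apply: contrapT => /separation[w [al [ws wy]]].
have al0 : 0 <= al.
  by have := ws 0; rewrite dot0r; apply; rewrite /= -lv0 inE eqxx.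
(* The midpoint stays positive even for [al = 0], so it can serve as divisor. *)
pose be := (al + dot w y) / 2.
have be0 : 0 < be by rewrite /be; lra.
have := yB (be^-1 *: w); rewrite dotZr mulrC ler_pdivrMr // mul1r dotC.
have -> : (dot w y <= be) = false by rewrite /be; lra.
move=> yw; suff /yw : B (be^-1 *: w) by [].
apply/BE => u us; rewrite dotZr mulrC ler_pdivrMr // mul1r dotC.
have := ws (lattice_vec R u); rewrite map_f ?inE ?us ?orbT // => /(_ isT).
by rewrite /be; lra.
Qed.

(** With [M] the sum of the absolute values of all entries of the normals, the sup-norm ball of
    radius [1 / (M + 1)] lies in [B]; the added 1 covers [M = 0]. *)
Lemma halfspaces_interior (s : seq 'rV[int]_n) (B : set 'rV[R]_n) :
  (forall z, B z <-> forall u, u \in s -> dot (lattice_vec R u) z <= 1) ->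
  B° 0.
Proof.
move=> BE; pose M := \sum_(u <- s) \sum_j `|lattice_vec R u 0 j|.
have M0 : 0 <= M by apply: sumr_ge0 => u _; apply: sumr_ge0.
have M1 : 0 < M + 1 by lra.
apply/nbhs_ballP; exists (M + 1)^-1; first by rewrite /= invr_gt0.
move=> z /= [_ zb]; apply/BE => u us.
apply: le_trans (_ : (\sum_j `|lattice_vec R u 0 j|) / (M + 1) <= 1).
  rewrite mulr_suml; apply: ler_sum => j _;
    rewrite (le_trans (ler_norm _)) // normrM.
  rewrite ler_wpM2l // ltW //.
  have := zb 0 j; rewrite mxE /ball /= sub0r normrN.
  exact.
rewrite ler_pdivrMr // mul1r (le_trans (y := M)) ?lerDl //.
rewrite /M (big_rem u) //= lerDl; apply: sumr_ge0 => v _; exact: sumr_ge0.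
Qed.

End LatticePolytopes.

Section Reflexivity.
Variables (R : realType) (d : nat) (G : simple_graph 'I_d) (le : rel 'I_d).
Hypotheses (leR : reflexive le) (leT : transitive le).

Let OP := [set a : 'rV[R]_d | in_order le 1 a].
Let QG := [set b : 'rV[R]_d | in_stable G 1 b].

(* The condition [deficit y C <= k - t] on [y = t - x] unfolds into the linear
   inequalities [t + \sum_(j in C) (x_j - x_(f j)) <= k], one for each choice of
   [f j <= j], where [None] stands for the last coordinate [t]. *)
Definition choice_coord (o : option 'I_d) : 'I_(d + 1) :=
  if o is Some l then lshift 1 l else rshift d ord0.

Definition clique_normal (Cf : {set 'I_d} * {ffun 'I_d -> option 'I_d}) :
    'rV[int]_(d + 1) :=
  delta_mx 0 (rshift d ord0) +
  \sum_(j in Cf.1)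
    (delta_mx 0 (lshift 1 j) - delta_mx 0 (choice_coord (Cf.2 j))).

Definition admissible (Cf : {set 'I_d} * {ffun 'I_d -> option 'I_d}) :=
  is_clique G Cf.1 && [forall j, if Cf.2 j is Some l then le l j else true].

(** The negated unit vectors express that coordinates are nonnegative after adding [(1, ..., 1)]. *)
Definition normals : seq 'rV[int]_(d + 1) :=
  [seq - delta_mx 0 j | j : 'I_(d + 1)] ++
    [seq clique_normal Cf | Cf <- enum admissible].

Lemma dot_delta n j (z : 'rV[R]_n) :
  dot (lattice_vec R (delta_mx 0 j)) z = z 0 j.
Proof.
rewrite /dot (bigD1 j) //= big1 => [|i /negPf ij]; rewrite !mxE ?ij ?mul0r //.
by rewrite !eqxx mul1r addr0.
Qed.

Lemma dot_clique_normal Cf (z : 'rV[R]_(d + 1)) :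
  dot (lattice_vec R (clique_normal Cf)) z = z 0 (rshift d ord0) +
    \sum_(j in Cf.1) (z 0 (lshift 1 j) - z 0 (choice_coord (Cf.2 j))).
Proof.
rewrite /clique_normal /lattice_vec map_mxD raddf_sum /= dotDl dot_delta.
congr (_ + _); rewrite dotC linear_sum; apply: eq_bigr => j _ /=.
by rewrite dotC map_mxB dotBl !dot_delta.
Qed.

(** The translation leaves the differences in a clique inequality unchanged and raises [t] by one,
    so the bound 2 becomes 1; likewise nonnegativity becomes a bound by 1. *)
Lemma dilate2_join z :
  dilate 2 (join_polytope OP QG) (z + const_mx 1) <->
  forall u, u \in normals -> dot (lattice_vec R u) z <= 1.
Proof.
pose x : 'rV[R]_d := lsubmx z + const_mx 1;
  pose t : R := z 0 (rshift d ord0) + 1.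
have -> : z + const_mx 1 = row_mx x (const_mx t).
  rewrite -[LHS]hsubmxK; congr row_mx; apply/rowP => j; rewrite !mxE //.
  by rewrite ord1.
pose y := const_mx t - x.
apply: iff_trans (dilate_join G leR leT 1 x t) _; rewrite -/y.
have yE j : y 0 j = z 0 (rshift d ord0) - z 0 (lshift 1 j) by rewrite !mxE /t;
  ring.
split=> [[yt yC] u|zu].
  rewrite mem_cat => /orP[/mapP[j _ ->]|/mapP[[C f]]].
    rewrite [lattice_vec R _](_ : _ = - lattice_vec R (delta_mx 0 j));
      last exact: map_mxN.
    rewrite dotNl dot_delta.
    case: (split_ordP j) => i ->.
      have : y 0 i <= posmax y by exact: le_bigmax.
      by rewrite yE; move: yt; rewrite /t; lra.
    by rewrite ord1; have := posmax_ge0 y; move: yt; rewrite /t; lra.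
  rewrite mem_enum => /andP[/= Ccl /forallP fle] ->;
    rewrite dot_clique_normal /=.
  suff : \sum_(j in C) (z 0 (lshift 1 j) - z 0 (choice_coord (f j))) <=
         deficit (converse le) y C by have := yC C Ccl; rewrite /t; lra.
  apply: ler_sum => j _; rewrite yE.
  suff : z 0 (rshift d ord0) - z 0 (choice_coord (f j)) <=
    upmax (converse le) y j by lra.
  have := fle j; case: (f j) => [l lj|_] /=; last by rewrite subrr upmax_ge0.
  by rewrite -yE; apply: le_bigmax_cond.
have coord_ge j : 0 <= 1 + z 0 j.
  have /zu : - delta_mx 0 j \in normals.
    by rewrite mem_cat; apply/orP; left; apply/mapP; exists j;
      rewrite ?mem_enum.
  rewrite [lattice_vec R _](_ : _ = - lattice_vec R (delta_mx 0 j));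
    last exact: map_mxN.
  by rewrite dotNl dot_delta; lra.
split=> [|C Ccl].
  apply/bigmax_leP; split=> [|j _]; first by rewrite /t addrC coord_ge.
  by rewrite yE /t; have := coord_ge (lshift 1 j); lra.
(* Choosing where each maximum is attained makes one inequality of the family carry the whole
   deficit of [C]. *)
have /choice[f fP] : forall j, exists o : option 'I_d,
  (if o is Some l then le l j else true) /\
    upmax (converse le) y j = z 0 (rshift d ord0) - z 0 (choice_coord o).
  move=> j; have [o oP oE] :=
    @bigmax_attained _ _ (converse le j) (fun l => y 0 l).
  exists o; split=> //; rewrite /upmax oE.
  by case: (o) => [l|] /=; rewrite ?yE ?subrr.
have /zu : clique_normal (C, [ffun j => f j]) \in normals.
  rewrite mem_cat; apply/orP; right; apply: map_f; rewrite mem_enum.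
  apply/andP; split=> //=; apply/forallP => j; rewrite ffunE;
    by case: (f j) (fP j).1.
rewrite dot_clique_normal /=.
rewrite [deficit _ _ _](_ : _ =
  \sum_(j in C) (z 0 (lshift 1 j) - z 0 (choice_coord ([ffun j => f j] j)))).
  by rewrite /t; lra.
by apply: eq_bigr => j _; rewrite ffunE (fP j).2 yE; ring.
Qed.

Lemma gorenstein_join :
  lattice_polytope OP -> lattice_polytope QG ->
  gorenstein_of_index 2 (join_polytope OP QG).
Proof.
move=> Ol Ql; have Jl := lattice_polytope_join Ol Ql; split=> //.
(* This moves the lattice point [(1, ..., 1)], interior to the second dilate, to the origin. *)
pose w : 'rV[int]_(d + 1) := const_mx (-1).
have shiftE (x : 'rV[R]_(d + 1)) :
    x *m map_mx intr 1%:M + lattice_vec R w = x - const_mx 1.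
  rewrite map_mx1 mulmx1; congr (_ + _); apply/rowP => j; rewrite !mxE.
  by rewrite rmorphN rmorph1.
exists [set x *m map_mx intr 1%:M + lattice_vec R w | x in dilate 2
  (join_polytope OP QG)];
  last by exists 1%:M, w; rewrite unitmx1.
set B := image _ _.
have BE z : B z <-> forall u, u \in normals -> dot (lattice_vec R u) z <= 1.
  rewrite -dilate2_join; split=> [[x xJ <-]|zJ]; first by rewrite shiftE subrK.
  by exists (z + const_mx 1); rewrite // shiftE addrK.
split; last exact: polar_dual_halfspaces BE; last exact: halfspaces_interior BE.
apply: (lattice_polytope_image (fz := fun z => z + w)).
- by move=> t x y; rewrite !shiftE; apply/rowP => j; rewrite !mxE; ring.
- by move=> z; rewrite map_mx1 mulmx1 /lattice_vec map_mxD.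
apply: (lattice_polytope_image (fz := fun z => 2 *: z)) Jl => [t x y|z].
  by apply/rowP => j; rewrite !mxE; ring.
by apply/rowP => j; rewrite !mxE rmorphM /= rmorph_nat.
Qed.

End Reflexivity.

Theorem theorem4p1 (R : realType) (d : nat)
    (disp : Order.disp_t) (P : finPOrderType disp)
    (p : 'I_d -> P) (p_bij : bijective p)
    (G : simple_graph 'I_d) (G_perfect : is_perfect G) :
  let O_P := @order_polytope R d disp P p in
  let Q_G := @stable_set_polytope R d G in
  [/\ (forall k : nat,
         delta_coef (join_polytope O_P Q_G) k = delta_coef (Gamma O_P Q_G) k),
      gorenstein_of_index 2 (join_polytope O_P Q_G)
    & normalized_volume (join_polytope O_P Q_G) =
      normalized_volume (Gamma O_P Q_G)].
Proof.
move=> O_P Q_G; pose le i j := (p i <= p j)%O.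
have leR : reflexive le by move=> i; apply: lexx.
have leA : antisymmetric le by move=> i j /le_anti/(bij_inj p_bij).
have leT : transitive le by move=> j i l; apply: le_trans.
have OE : O_P = [set a | in_order le 1 a] by apply: order_polytopeE.
have QE : Q_G = [set b | in_stable G 1 b] by apply: stable_set_polytopeE.
have deltaE k : delta_coef (join_polytope O_P Q_G) k =
  delta_coef (Gamma O_P Q_G) k.
  by rewrite OE QE delta_coef_join_Gamma.
split=> //; last by rewrite /normalized_volume;
  under eq_fsbigr do rewrite deltaE.
rewrite OE QE; apply: gorenstein_join => //.
  by rewrite -OE; apply: lattice_polytope_rho.
by rewrite -QE; apply: lattice_polytope_rho.
Qed.
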